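(* Let $H\colon[0,1]\times M\to\mathbb R$ be a smooth Hamiltonian, generating the contact isotopy $\Phi_H=\{\phi_H^t\}$, with $(\phi_H^t)^*\alpha=e^{h_t}\alpha$, and let $\epsilon>0$. Then there exists a smooth Hamiltonian $F\colon[0,1]\times M\to\mathbb R$, with $(\phi_F^t)^*\alpha=e^{f_t}\alpha$, such that the isotopy $\Phi_F$ coincides with a reparameterization of the isotopy $\Phi_H$, up to a small reparameterization with respect to the $L^{(1,\infty)}$-contact metric followed by a $C^\infty$-small perturbation, and (i) the end points of the isotopies coincide, i.e. $\phi_F^0=\phi_H^0$ and $\phi_F^1=\phi_H^1$; (ii) the norms satisfy the inequalities $\|F\|_{(1,\infty)}\le\|F\|_\infty<\|H\|_{(1,\infty)}+\epsilon$; (iii) the distances of the two isotopies to their common left end point satisfy the inequality $\overline d(\Phi_F,\phi_F^0)<\overline d(\Phi_H,\phi_H^0)+\epsilon$; (iv) for the conformal factors, $|f-f_0|<|h-h_0|+\epsilon$. In (iii), $\phi_F^0=\phi_H^0$ denotes the constant isotopy $t\mapsto\phi_F^0=\phi_H^0$, and in (iv), $f_0=h_0$ denotes its conformal factor.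
   Context: $M$ is a closed (compact, without boundary), connected smooth manifold of dimension $2n+1$ with a cooriented contact structure $\xi=\ker\alpha$, where $\alpha$ is a fixed contact form, and $\nu_\alpha=\alpha\wedge(d\alpha)^n$. $\mathrm{Diff}(M,\xi)$ is the group of diffeomorphisms $\phi$ with $\phi^*\alpha=e^{g}\alpha$ for a smooth function $g$ on $M$. A contact isotopy here is a smooth isotopy $\Phi=\{\phi_t\}_{0\le t\le1}$ in $\mathrm{Diff}(M,\xi)$, whose time-zero map $\phi_0\in\mathrm{Diff}(M,\xi)$ is not necessarily the identity; if $\frac{d}{dt}\phi_t=X_t\circ\phi_t$, its Hamiltonian is $H_t=\alpha(X_t)$, and one writes $\Phi=\Phi_H=\{\phi_H^t\}$ (for a given time-zero map, $H$ determines $\Phi_H$). Its conformal factor is the function $h\colon[0,1]\times M\to\mathbb R$ given by $(\phi_H^t)^*\alpha=e^{h_t}\alpha$. For a continuous function $H$ on $M$, $\|H\|=\max_M H-\min_M H+\left|\frac{1}{\int_M\nu_\alpha}\int_M H\,\nu_\alpha\right|$. For $H\colon[0,1]\times M\to\mathbb R$, $\|H\|_{(1,\infty)}=\int_0^1\|H_t\|\,dt$ and $\|H\|_\infty=\max_{0\le t\le1}\|H_t\|$. For conformal factors, $|h|=\max_{t,x}|h(t,x)|$. Let $d$ be the distance on $M$ given by a fixed Riemannian metric; for homeomorphisms $\overline d(\phi,\psi)=\max_x d(\phi(x),\psi(x))+\max_x d(\phi^{-1}(x),\psi^{-1}(x))$, and for isotopies $\overline d(\Phi,\Psi)=\max_t\overline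 d(\phi_t,\psi_t)$. The $L^{(1,\infty)}$-contact metric is $d_\alpha(\Phi_H,\Phi_F)=\overline d(\Phi_H,\Phi_F)+|h-f|+\|H-F\|_{(1,\infty)}$, where $h$ and $f$ are the conformal factors of $\Phi_H$ and $\Phi_F$. A reparameterization function is a smooth monotone function $\zeta\colon[0,1]\to[0,1]$ with $\zeta(0)=0$ and $\zeta(1)=1$; the corresponding reparameterization of $\Phi_H$ is the isotopy $\Phi_{H^\zeta}=\{\phi_H^{\zeta(t)}\}$, which has Hamiltonian $H^\zeta(t,x)=\zeta'(t)\,H(\zeta(t),x)$ and conformal factor $h_{\zeta(t)}$. *)

(* Defs.v *)
From HB Require Import structures.
From mathcomp Require Import all_boot all_order all_fingroup all_algebra.
From mathcomp Require Import all_classical all_reals all_analysis.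
Import Order.TTheory GRing.Theory Num.Theory numFieldNormedType.Exports.

Set Implicit Arguments.
Unset Strict Implicit.
Unset Printing Implicit Defensive.

Local Open Scope classical_set_scope.
Local Open Scope ring_scope.

(* Points of R^k are row vectors, covectors are column vectors, and linear    *)
(* maps act by multiplication on the right, as for [jacobian].                *)

Section SmoothEuclidean.
Context {R : realType} {k : nat}.
Implicit Types (U S : set 'rV[R]_k) (f g : 'rV[R]_k -> R).

Definition partial (i : 'I_k) f : 'rV[R]_k -> R :=
  fun x => 'D_(delta_mx 0 i) f x.

Definition partials (s : seq 'I_k) f : 'rV[R]_k -> R := foldr partial f s.

Fixpoint Ck (r : nat) U f : Prop :=
  (forall x, U x -> {for x, continuous f}) /\
  if r is r'.+1 then
    forall i, (forall x, U x -> derivable f x (delta_mx 0 i)) /\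
              Ck r' U (partial i f)
  else True.

(* Meant for an open set [U]. *)
Definition smooth_on U f : Prop := forall r, Ck r U f.

(* Smoothness on an arbitrary subset: local existence of smooth extensions.   *)
(* It is applied to sets such as [0, 1] x U with U open.                      *)
Definition smooth_in S f : Prop :=
  forall x, S x -> exists U g,
    [/\ open U, U x, smooth_on U g & forall y, U y -> S y -> g y = f y].

(* All partial derivatives of order at most r of f (a function on S) at x are *)
(* smaller than delta; on [0, 1] x U they do not depend on the extension g.   *)
Definition jet_lt S (r : nat) (delta : R) f (x : 'rV[R]_k) : Prop :=
  exists U g,
    [/\ open U, U x, smooth_on U g, (forall y, U y -> S y -> g y = f y) &
        forall s : seq 'I_k, (size s <= r)%N -> `|partials s g x| < delta].

End SmoothEuclidean.

Section UnitInterval.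
Context {R : realType}.

Definition I01 : set R := `[0, 1]%classic.

(* Derivative of a map defined on [0, 1]; it is one-sided at 0 and 1. *)
Definition is_derive01 {V : normedModType R} (f : R -> V) (t : R) (v : V) :=
  (fun s => (s - t)^-1 *: (f s - f t)) @ within I01 t^' --> v.

Definition derive01 (f : R -> R) (t : R) : R :=
  lim ((fun s => (s - t)^-1 *: (f s - f t)) @ within I01 t^').

Definition smooth01 (f : R -> R) : Prop :=
  smooth_in [set z : 'rV[R]_1 | I01 (z 0 0)] (fun z => f (z 0 0)).

Definition reparam_fun (zeta : R -> R) : Prop :=
  [/\ smooth01 zeta,
      (forall s t, I01 s -> I01 t -> s <= t -> zeta s <= zeta t),
      (forall t, I01 t -> I01 (zeta t)),
      zeta 0 = 0 & zeta 1 = 1].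

Definition reparam {T : Type} (zeta : R -> R) (u : R -> T) : R -> T :=
  fun t => u (zeta t).

Definition reparam_ham {T : Type} (zeta : R -> R) (H : R -> T -> R) :
    R -> T -> R :=
  fun t x => derive01 zeta t * H (zeta t) x.

(* [0, 1] x R^k inside R^(1 + k), the time being the first coordinate *)
Definition tx {k} (t : R) (x : 'rV[R]_k) : 'rV[R]_(1 + k) := row_mx t%:M x.
Definition time {k} (z : 'rV[R]_(1 + k)) : R := lsubmx z 0 0.
Definition space {k} (z : 'rV[R]_(1 + k)) : 'rV[R]_k := rsubmx z.

End UnitInterval.

Section Lebesgue.
Context {R : realType}.

(* Lebesgue integral over the box [a_0, b_0] x ... x [a_(k-1), b_(k-1)],      *)
(* as an iterated integral.                                                   *)
Fixpoint box_integral (k : nat) :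
    'rV[R]_k -> 'rV[R]_k -> ('rV[R]_k -> R) -> R :=
  match k with
  | 0 => fun _ _ f => f 0
  | k'.+1 => fun a b f =>
      \int[lebesgue_measure]_(t in `[time (k := k') a, time (k := k') b])
        box_integral (space (k := k') a) (space (k := k') b)
                     (fun y => f (tx t y))
  end.

Definition box {k} (a b : 'rV[R]_k) : set 'rV[R]_k :=
  [set y | forall i, a 0 i <= y 0 i <= b 0 i].

End Lebesgue.

(* Multilinear k-forms at a point, given by their values on the tuples of     *)
(* coordinate vectors, with the convention                                    *)
(* (A ^ B)(v_1, ...) = 1/(p! q!) \sum_s sgn(s) A(v_s(1), ...) B(v_s(p+1), ...)*)
Section Wedge.
Context {R : realType} {m : nat}.

Definition kform (k : nat) := ('I_k -> 'I_m) -> R.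

Definition wedge p q (A : kform p) (B : kform q) : kform (p + q) := fun e =>
  (p`! * q`!)%:R^-1 *
  \sum_(s : 'S_(p + q))
    (-1) ^+ odd_perm s *
    A (fun i => e (s (lshift q i))) * B (fun i => e (s (rshift p i))).

Fixpoint wedge_pow (B : kform 2) (r : nat) : kform (r * 2) :=
  match r with
  | 0 => fun _ => 1
  | r'.+1 => wedge B (@wedge_pow B r')
  end.

End Wedge.

(* The functions [fwd] and [bwd] are total, but only their restrictions to    *)
(* [dom] and to the image of [dom] matter.                                    *)
Record chart (R : realType) (M : topologicalType) (m : nat) := Chart {
  dom : set M;
  fwd :> M -> 'rV[R]_m;
  bwd : 'rV[R]_m -> M;
  dom_open : open dom;
  ran_open : open (fwd @` dom);
  fwd_continuous : {within dom, continuous fwd};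
  bwd_continuous : {within fwd @` dom, continuous bwd};
  fwdK : forall x, dom x -> bwd (fwd x) = x
}.

Definition ran {R M m} (c : @chart R M m) : set 'rV[R]_m := c @` dom c.

Record smooth_atlas (R : realType) (M : topologicalType) (m : nat) :=
  SmoothAtlas {
  charts :> chart R M m -> Prop;
  charts_cover : forall x, exists2 c, charts c & dom c x;
  charts_compatible : forall c c', charts c -> charts c' -> forall j,
    smooth_on (c @` (dom c `&` dom c')) (fun y => c' (bwd c y) 0 j)
}.

Section Manifold.
Context {R : realType} {M : ptopologicalType} {m : nat}.
Variable A : smooth_atlas R M m.
Implicit Types (phi : M -> M) (Phi : R -> M -> M) (c : chart R M m).

(* compact, without boundary, Hausdorff and connected; second countability    *)
(* follows from compactness                                                   *)
Definition closed_connected : Prop :=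
  [/\ hausdorff_space M, compact [set: M] & connected [set: M]].

Definition smooth_fun (u : M -> R) : Prop :=
  forall c, A c -> smooth_on (ran c) (u \o bwd c).

Definition local_rep c c' phi : 'rV[R]_m -> 'rV[R]_m :=
  fun y => c' (phi (bwd c y)).

Definition smooth_map phi : Prop :=
  continuous phi /\
  forall c c', A c -> A c' -> forall j,
    smooth_on (c @` (dom c `&` phi @^-1` dom c'))
              (fun y => local_rep c c' phi y 0 j).

Definition diffeo phi : Prop :=
  smooth_map phi /\
  exists psi, [/\ cancel phi psi, cancel psi phi & smooth_map psi].

(* the matrix of d phi at x in the charts c (at x) and c' (at phi x) *)
Definition tangent_mx c c' phi (x : M) : 'M[R]_m :=
  jacobian (local_rep c c' phi) (c x).

(* Smooth functions and maps on [0, 1] x M; values at times outside [0, 1]    *)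
(* are irrelevant.                                                            *)
Definition smooth_tfun (u : R -> M -> R) : Prop :=
  forall c, A c ->
    smooth_in [set z | I01 (time z) /\ ran c (space z)]
              (fun z => u (time z) (bwd c (space z))).

Definition tlocal_dom c c' Phi : set 'rV[R]_(1 + m) :=
  [set z | [/\ I01 (time z), ran c (space z) &
               dom c' (Phi (time z) (bwd c (space z)))]].

Definition tlocal_rep c c' Phi : 'rV[R]_(1 + m) -> 'rV[R]_m :=
  fun z => local_rep c c' (Phi (time z)) (space z).

Definition smooth_tmap Phi : Prop :=
  {within (I01 `*` [set: M]), continuous (fun p => Phi p.1 p.2)} /\
  forall c c', A c -> A c' -> forall j,
    smooth_in (tlocal_dom c c' Phi) (fun z => tlocal_rep c c' Phi z 0 j).

(* the weak (compact-open) C^oo topology on smooth maps [0, 1] x M -> M *)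
Definition Cr_basic_nbhs c c' (K : set (R * M)) (r : nat) (delta : R) Phi :
    set (R -> M -> M) :=
  [set Psi | forall t x, K (t, x) ->
    dom c' (Psi t x) /\
    forall j, jet_lt (tlocal_dom c c' Phi `&` tlocal_dom c c' Psi) r delta
      (fun z => tlocal_rep c c' Psi z 0 j - tlocal_rep c c' Phi z 0 j)
      (tx t (c x))].

Inductive Coo_nbhs Phi : set (R -> M -> M) -> Prop :=
| Coo_nbhs_basic c c' K r delta :
    A c -> A c' -> compact K ->
    K `<=` [set p | [/\ I01 p.1, dom c p.2 & dom c' (Phi p.1 p.2)]] ->
    0 < delta ->
    Coo_nbhs Phi (Cr_basic_nbhs c c' K r delta Phi)
| Coo_nbhsI N N' : Coo_nbhs Phi N -> Coo_nbhs Phi N' -> Coo_nbhs Phi (N `&` N')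
| Coo_nbhsS (N N' : set (R -> M -> M)) : Coo_nbhs Phi N ->
    (forall Psi, smooth_tmap Psi -> N Psi -> N' Psi) -> Coo_nbhs Phi N'.

(* Vector fields and 1-forms are given by their components in the charts:     *)
(* [X c x] and [a c x] are the components at x (in dom c) in the chart c.     *)
Definition vfield := chart R M m -> M -> 'rV[R]_m.

Record one_form := OneForm {
  form_at :> chart R M m -> M -> 'cV[R]_m;
  form_smooth : forall c, A c -> forall i,
    smooth_on (ran c) (fun y => form_at c (bwd c y) i 0);
  form_compatible : forall c c', A c -> A c' -> forall x,
    dom c x -> dom c' x ->
    form_at c x = tangent_mx c c' id x *m form_at c' x
}.

Definition pairing (v : 'rV[R]_m) (a : 'cV[R]_m) : R := (v *m a) 0 0.

Definition velocity c (gamma : R -> M) (t : R) (v : 'rV[R]_m) : Prop :=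
  is_derive01 (fun s => c (gamma s)) t v.

Record riemannian_metric := RiemannianMetric {
  metric_at :> chart R M m -> M -> 'M[R]_m;
  metric_smooth : forall c, A c -> forall i j,
    smooth_on (ran c) (fun y => metric_at c (bwd c y) i j);
  metric_sym : forall c, A c -> forall x, dom c x ->
    (metric_at c x)^T = metric_at c x;
  metric_pos : forall c, A c -> forall x, dom c x -> forall v : 'rV[R]_m,
    v != 0 -> 0 < pairing v (metric_at c x *m v^T);
  metric_compatible : forall c c', A c -> A c' -> forall x,
    dom c x -> dom c' x ->
    metric_at c x =
      tangent_mx c c' id x *m metric_at c' x *m (tangent_mx c c' id x)^T
}.

Section Distance.
Variable g : riemannian_metric.

Definition smooth_curve (gamma : R -> M) : Prop :=
  {within I01, continuous gamma} /\
  forall c, A c -> forall j,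
    smooth_in [set z : 'rV[R]_1 | I01 (z 0 0) /\ dom c (gamma (z 0 0))]
              (fun z => c (gamma (z 0 0)) 0 j).

Definition curve_length (gamma : R -> M) (l : R) : Prop :=
  exists speed : R -> R,
    (forall t, I01 t -> forall c, A c -> dom c (gamma t) ->
       exists2 v, velocity c gamma t v &
                  speed t = Num.sqrt (pairing v (g c (gamma t) *m v^T))) /\
    l = \int[lebesgue_measure]_(t in I01) speed t.

(* lengths of the piecewise smooth curves, i.e. of the finite concatenations  *)
(* of smooth curves                                                           *)
Inductive path_length : M -> M -> R -> Prop :=
| path_length_nil x : path_length x x 0
| path_length_cons gamma z l l' :
    smooth_curve gamma -> curve_length gamma l ->
    path_length (gamma 1) z l' -> path_length (gamma 0) z (l + l').

Definition dist (x y : M) : R := inf [set l | path_length x y l].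

Definition dbar phi psi : R :=
  sup [set dist (phi x) (psi x) | x in [set: M]] +
  sup [set dist (pinv setT phi x) (pinv setT psi x) | x in [set: M]].

Definition dbar_iso Phi Psi : R := sup [set dbar (Phi t) (Psi t) | t in I01].

End Distance.

End Manifold.

Section Contact.
Context {R : realType} {M : ptopologicalType} {n : nat}.

(* The dimension 1 + n * 2 is the degree of alpha ^ (d alpha)^n. *)
Let m := (1 + n * 2)%N.
Variables (A : smooth_atlas R M m) (alpha : one_form A).

Definition alpha_form (c : chart R M m) (x : M) : kform 1 :=
  fun e => alpha c x (e 0) 0.

Definition dalpha_form (c : chart R M m) (x : M) : kform 2 := fun e =>
  partial (e 0) (fun y => alpha c (bwd c y) (e 1) 0) (c x) -
  partial (e 1) (fun y => alpha c (bwd c y) (e 0) 0) (c x).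

(* the coefficient of nu_alpha = alpha ^ (d alpha)^n in the chart c, i.e. its *)
(* value on the coordinate frame                                              *)
Definition nu_coef (c : chart R M m) (x : M) : R :=
  wedge (alpha_form c x) (wedge_pow (r := n) (dalpha_form c x)) id.

Definition contact_form : Prop :=
  forall c, A c -> forall x, dom c x -> nu_coef c x != 0.

Definition borel_type := g_sigma_algebraType (@open M).

(* mu is the Borel measure on M given by nu_alpha, so that the integral of    *)
(* u * nu_alpha over M, oriented by nu_alpha, is the integral of u against mu.*)
(* The measure mu is unique: closed boxes contained in the ranges of charts   *)
(* form pi-systems that generate the Borel sets of the chart domains.         *)
Definition volume_measure (mu : {measure set borel_type -> \bar R}) : Prop :=
  forall c, A c -> forall a b : 'rV[R]_m, box a b `<=` ran c ->
    mu (bwd c @` box a b) =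
      (box_integral a b (fun y => `|nu_coef c (bwd c y)|))%:E.

(* phi^* alpha = e^u alpha *)
Definition conformal (phi : M -> M) (u : M -> R) : Prop :=
  forall c c', A c -> A c' -> forall x, dom c x -> dom c' (phi x) ->
    tangent_mx c c' phi x *m alpha c' (phi x) = expR (u x) *: alpha c x.

(* the group Diff(M, xi) *)
Definition contact_diffeo (phi : M -> M) : Prop :=
  diffeo A phi /\ exists2 u, smooth_fun A u & conformal phi u.

Definition contact_isotopy (Phi : R -> M -> M) : Prop :=
  smooth_tmap A Phi /\ forall t, I01 t -> contact_diffeo (Phi t).

Definition generates (H : R -> M -> R) (Phi : R -> M -> M) : Prop :=
  exists X : R -> vfield,
    (forall t, I01 t -> forall x c, A c -> dom c (Phi t x) ->
       velocity c (fun s => Phi s x) t (X t c (Phi t x))) /\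
    (forall t, I01 t -> forall y c, A c -> dom c y ->
       H t y = pairing (X t c y) (alpha c y)).

Definition conformal_factor (Phi : R -> M -> M) (h : R -> M -> R) : Prop :=
  forall t, I01 t -> conformal (Phi t) (h t).

Variable mu : {measure set borel_type -> \bar R}.

Definition mean (u : M -> R) : R :=
  (fine (mu [set: M]))^-1 * Rintegral mu [set: M] u.

Definition ham_norm (u : M -> R) : R :=
  sup (range u) - inf (range u) + `|mean u|.

Definition norm_1oo (H : R -> M -> R) : R :=
  \int[lebesgue_measure]_(t in I01) ham_norm (H t).

Definition norm_oo (H : R -> M -> R) : R := sup [set ham_norm (H t) | t in I01].

Definition conf_norm (h : R -> M -> R) : R :=
  sup [set `|h p.1 p.2| | p in I01 `*` [set: M]].

(* the L^(1,oo)-contact metric; [H], [h] (resp. [F], [f]) are meant to be the *)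
(* Hamiltonian and the conformal factor of [Phi] (resp. [Psi])                *)
Definition contact_dist (g : riemannian_metric A)
    (Phi : R -> M -> M) (H h : R -> M -> R)
    (Psi : R -> M -> M) (F f : R -> M -> R) : R :=
  dbar_iso g Phi Psi + conf_norm (fun t x => h t x - f t x) +
  norm_1oo (fun t x => H t x - F t x).

End Contact.

(* Main.v *)
Require Import Defs.
From mathcomp Require Import all_boot all_order all_algebra.
From mathcomp Require Import all_classical all_reals all_analysis.
From mathcomp Require Import ring lra.
Import Order.TTheory GRing.Theory Num.Theory numFieldNormedType.Exports.
Local Open Scope classical_set_scope.
Local Open Scope ring_scope.

(* No perturbation is needed: a suitable reparametrisation of the isotopy already
   works. Choose a polynomial [w > 0] with [||H_s|| < w(s) < ||H_s|| + e] on
   [0, 1], which exists because [s |-> ||H_s||] is continuous, and let [zeta] be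
   the inverse of [s |-> \int_0^s w / \int_0^1 w]. Then
   [||zeta'(t) H_zeta(t)|| = (\int_0^1 w) ||H_zeta(t)|| / w(zeta(t))] is less than
   [\int_0^1 w <= ||H||_(1,oo) + e]. Since [zeta] maps [0, 1] onto itself and fixes
   its end points, the end points of the isotopy and the suprema in (iii) and (iv)
   do not change. The second reparametrisation is the identity. *)

(** * Polynomial approximation on [0, 1] *)

(** A polynomial [w] removes both defects. It is kept positive on the whole line and not just on
    [[0, 1]], so that [zeta] is a smooth bijection of the line with [zeta' > 0]. Three things
    follow: local smooth extensions beyond [[0, 1]] can be composed with the change of time,
    derivatives of [zeta] within [[0, 1]] are ordinary derivatives, and [zeta] is injective, so that
    difference quotients of the reparametrised isotopy can be divided by [zeta s - zeta t]. *)

(* [\sum_k 'C(n, k) * f k * x ^+ k * (1 - x) ^+ (n - k)], by conditioning on the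
   first of [n] Bernoulli trials, which makes the moments easy inductions. *)
Fixpoint bernstein {R : comNzRingType} (n : nat) (f : nat -> R) : {poly R} :=
  if n is n'.+1 then
    'X * bernstein n' (fun k => f k.+1) + (1 - 'X) * bernstein n' f
  else (f 0%N)%:P.

Lemma hornerS_bernstein (R : comNzRingType) n (f : nat -> R) x :
  (bernstein n.+1 f).[x] =
  x * (bernstein n (fun k => f k.+1)).[x] + (1 - x) * (bernstein n f).[x].
Proof. by rewrite /= !(hornerE, hornerM). Qed.

Lemma bernstein_affine (R : comNzRingType) n (f g : nat -> R) a x :
  (bernstein n (fun k => f k + a * g k)).[x] =
  (bernstein n f).[x] + a * (bernstein n g).[x].
Proof.
elim: n f g => [|n IH] f g; first by rewrite /= !hornerE.
by rewrite !hornerS_bernstein (IH f g) (IH (fun k => f k.+1) (fun k => g k.+1)); ring.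
Qed.

Lemma bernstein_cst (R : comNzRingType) n (a x : R) :
  (bernstein n (fun=> a)).[x] = a.
Proof.
elim: n => [|n IH]; first by rewrite /= !hornerE.
by rewrite hornerS_bernstein IH; ring.
Qed.

(** Second moment of a binomial variable about an arbitrary centre [a]; the variance is the case
    [a = n x]. The centre must vary for the induction, since conditioning on a success replaces [a]
    by [a - 1]. *)
Lemma bernstein_variance (R : comNzRingType) n (a x : R) :
  (bernstein n (fun k => (k%:R - a) ^+ 2)).[x] =
  n%:R * x * (1 - x) + (n%:R * x - a) ^+ 2.
Proof.
elim: n a => [|n IH] a; first by rewrite /= !hornerE; ring.
rewrite hornerS_bernstein IH.
under [X in bernstein n X]boolp.funext => k do
  rewrite -natr1 -addrA -[1 - a]opprB.
by rewrite IH -natr1; ring.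
Qed.

Lemma ler_bernstein (R : realDomainType) n (f g : nat -> R) x :
  0 <= x <= 1 -> (forall k, (k <= n)%N -> f k <= g k) ->
  (bernstein n f).[x] <= (bernstein n g).[x].
Proof.
move=> /andP[x0 x1]; elim: n f g => [|n IH] f g fg.
  by rewrite /= !hornerE fg.
rewrite !hornerS_bernstein lerD// ler_wpM2l// ?subr_ge0//.
  by apply: IH => k kn; exact: fg.
by apply: IH => k kn; apply: fg; rewrite (leq_trans kn).
Qed.

Section Weierstrass.
Context {R : realType}.
Implicit Types u : R -> R.

(** Heine-Cantor: compactness in covering form, applied to the filter of moduli [d] tending to 0
    from the right. *)
Lemma within_I01_unif_continuous u : {within I01, continuous u} ->
  forall e, 0 < e -> exists2 d, 0 < d & forall x y, I01 x -> I01 y ->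
    `|x - y| < d -> `|u x - u y| < e.
Proof.
move=> /subspace_continuousP cu e e0.
have /compact_near_coveringP/near_covering_withinP cov :=
  @segment_compact R 0 1.
have /= := cov _ (0 : R)^'+ (fun d x => forall y, I01 y -> `|x - y| < d ->
   `|u x - u y| < e).
case.
  move=> x Ix.
  have /cvgrPdist_lt/(_ (e / 2)) := cu _ Ix.
  rewrite divr_gt0// => /(_ isT); rewrite near_withinE.
  move=> /nbhs_ballP[d /= d0 dP].
  near=> x' d' => /= Ix' y Iy xy.
  have xx' : `|x - x'| < d / 2.
    near: x'; apply/nbhs_ballP; exists (d / 2); first by rewrite /= divr_gt0.
    by move=> z; rewrite /ball/=.
  have d'd : d' < d / 2 by near: d'; apply: nbhs_right_lt; rewrite divr_gt0.
  have := dP x' _ Ix'; have := dP y _ Iy; rewrite /ball/= => h1 h2.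
  have := ler_distD x' x y; have := ler_distD (u x) (u x') (u y).
  rewrite (distrC (u x') (u x)) => t1 t2.
  have {}h1 : `|u x - u y| < e / 2 by apply: h1; lra.
  have {}h2 : `|u x - u x'| < e / 2 by apply: h2; lra.
  lra.
move=> d /= d0 dP.
exists (d / 2); first by rewrite divr_gt0.
move=> x y Ix Iy xy.
by apply: (dP (d / 2)) => //=; [rewrite sub0r normrN gtr0_norm; lra|lra].
Unshelve. all: by end_near. Qed.

Lemma within_I01_bounded u : {within I01, continuous u} ->
  exists2 K, 0 < K & forall x, I01 x -> `|u x| <= K.
Proof.
move=> cu.
have /ex_strict_bound_gt0[K K0 KP] : bounded_set (u @` I01).
  exact/compact_bounded/continuous_compact/segment_compact.
by exists K => // x Ix; apply/ltW/KP; exists x.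
Qed.

(** Chebyshev's argument. At nodes closer to [x] than [d], uniform continuity bounds the error by
    [e / 2]; at the others the error is at most [2 K], which [2 K (k / n - x)^2 / d^2] dominates.
    Averaging the sum of both bounds leaves [e / 2] plus a multiple of the variance, and [n] is
    chosen to make the latter smaller than [e / 2]. *)
Lemma weierstrass u : {within I01, continuous u} -> forall e, 0 < e ->
  exists p : {poly R}, forall x, I01 x -> `|p.[x] - u x| < e.
Proof.
move=> cu e e0.
have [d d0 dP] := within_I01_unif_continuous _ cu (e / 2) ltac:(lra).
have [K K0 KP] := within_I01_bounded _ cu.
have C0 : 0 < 2 * K / d ^+ 2 by rewrite divr_gt0 ?exprn_gt0; lra.
have [n n0 nP] : exists2 n : nat, (0 < n)%N &
    2 * K / d ^+ 2 < n%:R * (e / 2).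
  pose n := (Num.trunc (2 * K / d ^+ 2 / (e / 2))).+1.
  exists n => //; rewrite -ltr_pdivrMr; last lra.
  exact: truncnS_gt.
have nR0 : (0 : R) < n%:R by rewrite ltr0n.
exists (bernstein n (fun k => u (k%:R / n%:R))) => x Ix.
have Ix' : 0 <= x <= 1 by move: Ix; rewrite /I01/= in_itv.
pose c := 2 * K / d ^+ 2 / n%:R ^+ 2.
have bnd k : (k <= n)%N ->
  `|u (k%:R / n%:R) - u x| <= e / 2 + c * (k%:R - n%:R * x) ^+ 2.
  move=> kn.
  have Ik : I01 (k%:R / n%:R : R).
    by rewrite /I01/= in_itv/= divr_ge0//= ler_pdivrMr// mul1r ler_nat.
  have c0 : 0 <= c by rewrite divr_ge0 ?exprn_ge0// ltW.
  have [xd|xd] := ltP (`|k%:R / n%:R - x|) d.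
    apply: (@le_trans _ _ (e / 2)); first exact/ltW/dP.
    by rewrite lerDl mulr_ge0// sqr_ge0.
  have -> : c * (k%:R - n%:R * x) ^+ 2 =
      2 * K / d ^+ 2 * (k%:R / n%:R - x) ^+ 2.
    by rewrite /c; field; rewrite !gt_eqF//.
  have : 2 * K <= 2 * K / d ^+ 2 * (k%:R / n%:R - x) ^+ 2.
    rewrite mulrAC ler_pdivlMr ?exprn_gt0// ler_wpM2l//; first lra.
    by rewrite -(real_normK (num_real (_ - x))) lerXn2r// nnegrE ltW.
  have := KP _ Ik; have := KP _ Ix; have := ler_normB (u (k%:R / n%:R)) (u x).
  lra.
have E : (bernstein n (fun k => e / 2 + c * (k%:R - n%:R * x) ^+ 2)).[x] < e.
  rewrite (bernstein_affine _ _ (fun=> e / 2)) bernstein_cst bernstein_variance.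
  rewrite subrr expr0n addr0 /c.
  have -> : 2 * K / d ^+ 2 / n%:R ^+ 2 * (n%:R * x * (1 - x)) =
     2 * K / d ^+ 2 / n%:R * (x * (1 - x)).
    by field; rewrite !gt_eqF.
  have : 2 * K / d ^+ 2 / n%:R * (x * (1 - x)) <= 2 * K / d ^+ 2 / n%:R.
    by rewrite ler_piMr// ?ltW ?divr_gt0//; move: Ix' => /andP[]; nra.
  have : 2 * K / d ^+ 2 / n%:R < e / 2 by rewrite ltr_pdivrMr// [e / 2 * _]mulrC.
  lra.
apply: le_lt_trans E.
(* The two one-sided forms of [bnd] are averaged separately; the coefficients [-1] and [1] give them
   the shape of [bernstein_affine]. *)
have lo := ler_bernstein _ n
  (fun k => u x + (-1) * (e / 2 + c * (k%:R - n%:R * x) ^+ 2))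
  (fun k => u (k%:R / n%:R)) x Ix'.
have hi := ler_bernstein _ n (fun k => u (k%:R / n%:R))
  (fun k => u x + 1 * (e / 2 + c * (k%:R - n%:R * x) ^+ 2)) x Ix'.
rewrite !(bernstein_affine _ _ (fun=> u x)) !bernstein_cst in lo hi.
rewrite ler_norml; apply/andP; split.
  suff /lo : forall k, (k <= n)%N ->
      u x + -1 * (e / 2 + c * (k%:R - n%:R * x) ^+ 2) <= u (k%:R / n%:R) by lra.
  by move=> k /bnd; rewrite ler_norml => /andP[]; lra.
suff /hi : forall k, (k <= n)%N ->
    u (k%:R / n%:R) <= u x + 1 * (e / 2 + c * (k%:R - n%:R * x) ^+ 2) by lra.
by move=> k /bnd; rewrite ler_norml => /andP[]; lra.
Qed.

End Weierstrass.

(** * The reparametrisation function *)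

Section SmoothLine.
Context {R : realType}.
Implicit Types a b zeta : R -> R.

(** Counterpart of [Ck] for functions on the whole line; the change of time is defined there, so no
    extension past 0 and 1 has to be chosen. *)
Fixpoint Cline (r : nat) a : Prop :=
  if r is r'.+1 then (forall t : R, derivable a t 1) /\ Cline r' (derive1 a)
  else continuous a.

Definition smooth_line a : Prop := forall r, Cline r a.

Lemma is_derive1_continuous a a' :
  (forall t : R, is_derive t 1 a (a' t)) -> continuous a.
Proof.
by move=> da t; exact/differentiable_continuous/derivable1_diffP/ex_derive.
Qed.

Lemma ClineS r a a' :
  (forall t : R, is_derive t 1 a (a' t)) -> Cline r a' -> Cline r.+1 a.
Proof.
move=> da Ca; split; first by move=> t; exact: ex_derive.
suff -> : (derive1 a) = a' by [].
by apply/funext => t; rewrite derive1E derive_val.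
Qed.

Lemma Cline_is_derive r a (t : R) : Cline r.+1 a -> is_derive t 1 a ((derive1 a) t).
Proof. by move=> [da _]; apply: DeriveDef; rewrite ?derive1E. Qed.

Lemma ClineW r a : Cline r.+1 a -> Cline r a.
Proof.
elim: r a => [|r IH] a Ca.
  exact: is_derive1_continuous (fun t => Cline_is_derive _ _ t Ca).
by split; [exact: Ca.1|exact: IH Ca.2].
Qed.

Lemma Cline_continuous r a : Cline r a -> continuous a.
Proof. by elim: r => [//|r IH] /ClineW. Qed.

Lemma ClineD r a b : Cline r a -> Cline r b -> Cline r (fun t => a t + b t).
Proof.
elim: r a b => [|r IH] a b Ca Cb; first by move=> t; exact: cvgD (Ca t) (Cb t).
apply: (@ClineS _ _ (fun t => (derive1 a) t + (derive1 b) t)); last exact: IH Ca.2 Cb.2.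
move=> t; have da := Cline_is_derive _ _ t Ca; have db := Cline_is_derive _ _ t Cb.
exact: is_deriveD.
Qed.

Lemma ClineM r a b : Cline r a -> Cline r b -> Cline r (fun t => a t * b t).
Proof.
elim: r a b => [|r IH] a b Ca Cb; first by move=> t; exact: cvgM (Ca t) (Cb t).
apply: (@ClineS _ _ (fun t => a t * (derive1 b) t + b t * (derive1 a) t)); last first.
  by apply: ClineD; apply: IH; [exact: ClineW|exact: Cb.2|exact: ClineW|exact: Ca.2].
move=> t; have da := Cline_is_derive _ _ t Ca; have db := Cline_is_derive _ _ t Cb.
exact: is_deriveM.
Qed.

Lemma smooth_line_cst (c : R) : smooth_line (fun=> c).
Proof.
move=> r; elim: r c => [|r IH] c; first exact: cst_continuous.
exact: ClineS (fun t => is_derive_cst c t 1) (IH 0).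
Qed.

Lemma smooth_line_id : smooth_line id.
Proof.
case=> [|r]; first by move=> t; exact: cvg_id.
exact: ClineS (fun t => is_derive_id t 1) (smooth_line_cst 1 r).
Qed.

(** * Inverse of a polynomial whose derivative is bounded below *)

Section InversePolynomial.
Variables (p : {poly R}) (c : R) (zeta : R -> R).
Hypothesis (c_gt0 : 0 < c) (p'_ge : forall s, c <= p^`().[s]).

Lemma horner_incr (s t : R) : s <= t -> c * (t - s) <= p.[t] - p.[s].
Proof.
move=> st.
have [|x _ ->] := @MVT_segment R (horner p) (horner p^`()) s t st.
  exact/continuous_subspaceT/continuous_horner.
by rewrite ler_wpM2r// subr_ge0.
Qed.

Lemma horner_bijective : exists zeta, cancel zeta (horner p) /\ cancel (horner p) zeta.
Proof.
have inj : injective (horner p).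
  move=> s t pst; apply/eqP; wlog st : s t pst / s <= t.
    by move=> W; have [/W->//|/ltW/W] := leP s t; rewrite eq_sym => ->.
  have := horner_incr _ _ st; rewrite pst subrr pmulr_rle0// subr_le0.
  by move=> ts; rewrite eq_le st.
have /choice[z zP] t : exists s, p.[s] = t.
  (* Growing at rate at least [c] from [p.[0]], the polynomial has passed [t] within distance [b] of
     0, on one side or the other. *)
  pose b := `|t - p.[0]| / c.
  have b0 : 0 <= b by rewrite divr_ge0// ltW.
  have cb : c * b = `|t - p.[0]| by rewrite /b mulrC divfK// gt_eqF.
  have h1 : p.[- b] <= t.
    have := horner_incr (- b) 0; rewrite oppr_le0 => /(_ b0).
    by rewrite sub0r opprK cb; have := ler_norm (p.[0] - t); rewrite distrC; lra.
  have h2 : t <= p.[b].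
    have := horner_incr 0 b b0; rewrite subr0 cb.
    by have := ler_norm (t - p.[0]); lra.
  have [|||s _ <-] := @IVT R (horner p) (- b) b t; last by exists s.
  - by lra.
  - exact/continuous_subspaceT/continuous_horner.
  - by rewrite ge_min h1 le_max h2 orbT.
by exists z; split => // s; apply: inj.
Qed.

Hypotheses (pK : cancel (horner p) zeta) (zetaK : cancel zeta (horner p)).

Lemma is_derive_inverse_poly (t : R) : is_derive t 1 zeta (p^`().[zeta t])^-1.
Proof.
rewrite -{1}(zetaK t); apply: is_derive_inverse.
- by near=> s; exact: pK.
- by near=> s; exact: continuous_horner.
- by rewrite gt_eqF// (lt_le_trans c_gt0).
Unshelve. all: by end_near. Qed.

(* As [zeta' = 1 / p'(zeta)], these functions are stable under differentiation;
   [q = 'X] and [k = 0] give [zeta] itself. *)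
Lemma Cline_rational_inverse r (q : {poly R}) k :
  Cline r (fun t => q.[zeta t] * (p^`().[zeta t] ^+ k)^-1).
Proof.
have wN0 s : p^`().[s] != 0 by rewrite gt_eqF// (lt_le_trans c_gt0).
(* The quotient rule gives the denominator [p' ^ (j + 1)], and the factor [zeta' = 1 / p'(zeta)] of
   the chain rule raises the exponent to [j + 2]. *)
have D (q' : {poly R}) (j : nat) (t : R) :
    is_derive t 1 (fun t => q'.[zeta t] * (p^`().[zeta t] ^+ j)^-1)
      ((q'^`() * p^`() - (j%:R *: q') * p^`()^`()).[zeta t] *
       (p^`().[zeta t] ^+ j.+2)^-1).
  have dz := is_derive_inverse_poly t.
  have wjN0 : (p^`() ^+ j).[zeta t] != 0 by rewrite horner_exp expf_neq0.
  have dwj := is_deriveV wjN0 (is_derive_poly (p^`() ^+ j) (zeta t)).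
  have dF := is_deriveM (is_derive_poly q' (zeta t)) dwj.
  have := is_derive1_comp dF dz.
  rewrite (_ : _ \o zeta = fun t => q'.[zeta t] * (p^`().[zeta t] ^+ j)^-1); last first.
    by apply/funext => s; rewrite -horner_exp.
  move=> dqw; apply: is_derive_eq dqw _.
  rewrite deriv_exp -[X in X / _ = _]/(_ * (- _ * _) + _ * _).
  rewrite !(hornerE, hornerMn, horner_exp) -mulr_natr.
  have := wN0 (zeta t); set w := (p^`()).[_] => w0.
  case: j {wjN0 dwj dF} => [|j] /=; first by field.
  have := expf_neq0 j w0; rewrite !exprS; set v := w ^+ j => v0.
  by field; rewrite v0 w0.
elim: r q k => [|r IH] q k; first exact: is_derive1_continuous (D q k).
exact: ClineS (D q k) (IH _ _).
Qed.

End InversePolynomial.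

Lemma exists_primitive (p : {poly R}) : exists q : {poly R}, q^`() = p.
Proof.
(* At [i = 0] the coefficient is a quotient by 0, hence 0 by convention; it does not affect the
   derivative. *)
exists (\poly_(i < (size p).+1) (p`_i.-1 / i%:R)).
apply/polyP => i; rewrite coef_deriv coef_poly ltnS /=.
case: ltnP => [ip|ip]; last by rewrite mul0rn nth_default.
by rewrite -[LHS]mulr_natr divfK// pnatr_eq0.
Qed.

Lemma measurable_I01 : measurable (I01 : set (measurableTypeR R)).
Proof. exact: measurable_itv. Qed.

Lemma Rintegral_I01_cst (e : R) :
  \int[lebesgue_measure]_(t in (I01 : set R)) e = e.
Proof.
rewrite Rintegral_cst; last exact: measurable_I01.
rewrite -[RHS]mulr1; congr (_ * _).
rewrite [X in fine X](_ : _ = 1%E)//.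
by apply: etrans (lebesgue_measure_itv `[0, 1]) _; rewrite /= lte01 oppr0 adde0.
Qed.

Lemma within_I01_integrable a : {within I01, continuous a} ->
  lebesgue_measure.-integrable I01 (EFin \o a).
Proof. exact/continuous_compact_integrable/segment_compact. Qed.

Lemma Rintegral_poly (p : {poly R}) :
  \int[lebesgue_measure]_(t in I01) p^`().[t] = p.[1] - p.[0].
Proof.
rewrite /Rintegral (@continuous_FTC2 _ _ (horner p) 0 1)//.
- exact/continuous_subspaceT/continuous_horner.
- split.
  + by move=> x _; exact: derivable_horner.
  + exact/cvg_at_right_filter/continuous_horner.
  + exact/cvg_at_left_filter/continuous_horner.
- by move=> x _; rewrite derivE.
Qed.

Lemma exists_reparam (u : R -> R) (e : R) : {within I01, continuous u} ->
  (forall t, I01 t -> 0 <= u t) -> 0 < e ->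
  exists zeta : R -> R,
    [/\ [/\ smooth_line zeta, zeta 0 = 0 & zeta 1 = 1],
        (forall t : R, derivable zeta t 1), (forall t, 0 < (derive1 zeta) t) &
        (forall t, I01 t -> (derive1 zeta) t * u (zeta t) <=
          \int[lebesgue_measure]_(t in I01) u t + e)].
Proof.
move=> cu u0 e0.
(* The square root of [u] is approximated rather than [u] itself: the square of the polynomial is
   then nonnegative on the whole line, and adding [e / 2] makes it positive there. *)
have cv : {within I01, continuous (fun t => Num.sqrt (u t))}.
  by move=> t; apply: continuous_comp; [exact: cu|exact: sqrt_continuous].
have [K K0 KP] := within_I01_bounded _ cv.
(* With [v = sqrt u <= K] and [eta <= 1], one has [|p + v| <= 2 K + 1], so
   [|p^2 - u| <= eta (2 K + 1) <= e / 4]. Adding [e / 2] then places [w] strictly between [u] and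
   [u + e]. *)
pose eta := Num.min 1 (e / (4 * (2 * K + 1))).
have C0 : 0 < 4 * (2 * K + 1) by lra.
have eta0 : 0 < eta by rewrite lt_min ltr01 divr_gt0.
have [p pP] := weierstrass _ cv eta eta0.
pose w := p ^+ 2 + (e / 2)%:P.
have wE s : w.[s] = p.[s] ^+ 2 + e / 2 by rewrite /w !(hornerE, horner_exp).
have uw t : I01 t -> u t < w.[t] < u t + e.
  move=> It; rewrite wE; have := pP t It; have := KP t It.
  rewrite -[in _ < _ < _](sqr_sqrtr (u0 t It)) ger0_norm ?sqrtr_ge0//.
  have := sqrtr_ge0 (u t); set v := Num.sqrt _ => v0 vK.
  have e1 : eta <= 1 by rewrite ge_min lexx.
  have e2 : eta * (4 * (2 * K + 1)) <= e.
    by rewrite -ler_pdivlMr// ge_min lexx orbT.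
  rewrite ltr_norml => /andP[l1 l2].
  have : `|p.[t] ^+ 2 - v ^+ 2| <= eta * (2 * K + 1).
    rewrite subr_sqr normrM ler_pM//; first by rewrite ler_norml; lra.
    by rewrite ler_norml; lra.
  by rewrite ler_norml; lra.
have [q qE] := exists_primitive w.
pose W := q.[1] - q.[0].
have WE : W = \int[lebesgue_measure]_(t in I01) w.[t] by rewrite -qE Rintegral_poly.
have wint : lebesgue_measure.-integrable I01 (EFin \o horner w).
  exact/within_I01_integrable/continuous_subspaceT/continuous_horner.
have Wle : W <= \int[lebesgue_measure]_(t in I01) u t + e.
  have -> : e = \int[lebesgue_measure]_(t in (I01 : set R)) e.
    by rewrite Rintegral_I01_cst.
  have eint : lebesgue_measure.-integrable (I01 : set R) (EFin \o (fun=> e)).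
    exact/within_I01_integrable/continuous_subspaceT/cst_continuous.
  rewrite -RintegralD//; [|exact: measurable_I01|exact: within_I01_integrable].
  rewrite WE; apply: le_Rintegral => //; first exact: measurable_I01.
    apply/within_I01_integrable => t.
    by apply: cvgD; [exact: cu|exact: cst_continuous].
  by move=> t /uw/andP[_ /ltW].
have W0 : 0 < W.
  have [|x _ E] := @MVT_segment R (horner q) (horner q^`()) 0 1 ler01.
    exact/continuous_subspaceT/continuous_horner.
  by rewrite /W E qE wE; have := sqr_ge0 p.[x]; lra.
pose P := W^-1 *: (q - q.[0]%:P).
have P'E s : P^`().[s] = W^-1 * w.[s].
  by rewrite /P derivZ derivB derivC qE subr0 !hornerE.
have c0 : 0 < W^-1 * (e / 2) by rewrite mulr_gt0 ?invr_gt0//; lra.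
have P'ge s : W^-1 * (e / 2) <= P^`().[s].
  by rewrite P'E wE ler_pM2l ?invr_gt0//; have := sqr_ge0 p.[s]; lra.
have [zeta [zetaK PK]] := horner_bijective _ _ c0 P'ge.
have dz t := is_derive_inverse_poly _ _ _ c0 P'ge PK zetaK t.
have dzE t : (derive1 zeta) t = W / w.[zeta t].
  by rewrite derive1E derive_val P'E invfM invrK.
have w0 s : 0 < w.[s] by rewrite wE; have := sqr_ge0 p.[s]; lra.
have P0 : P.[0] = 0 by rewrite /P !hornerE subrr mulr0.
have P1 : P.[1] = 1 by rewrite /P !hornerE mulVf// gt_eqF.
have z0 : zeta 0 = 0 by rewrite -P0 PK.
have z1 : zeta 1 = 1 by rewrite -P1 PK.
have z'0 t : 0 < (derive1 zeta) t by rewrite dzE divr_gt0.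
exists zeta; split => //.
  split => // r.
  have := Cline_rational_inverse _ _ _ c0 P'ge PK zetaK r 'X 0.
  congr Cline; apply/funext => t.
  by rewrite hornerX expr0 invr1 mulr1.
move=> t It; apply: le_trans Wle.
have Iz : I01 (zeta t).
  have inc s s' : s <= s' -> zeta s <= zeta s'.
    move=> ss; rewrite leNgt; apply/negP => lt.
    have := horner_incr _ _ P'ge _ _ (ltW lt); rewrite !zetaK.
    rewrite leNgt => /negP; apply; rewrite (@le_lt_trans _ _ 0) ?subr_le0//.
    by rewrite mulr_gt0// subr_gt0.
  move: It; rewrite /I01/= !in_itv/= => /andP[t0 t1].
  by have := inc _ _ t0; have := inc _ _ t1; rewrite z0 z1 => -> ->.
have /andP[uwz _] := uw _ Iz.
by rewrite dzE mulrAC ler_pdivrMr// ler_pM2l// ltW.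
Qed.

End SmoothLine.

(** * Smoothness of composites with a change of time *)

Section CkTheory.
Context {R : realType} {k : nat}.
Implicit Types (U : set 'rV[R]_k) (f g : 'rV[R]_k -> R).

Lemma Ck_continuous r U f x : Ck r U f -> U x -> {for x, continuous f}.
Proof. by case: r => [|r] [cf _]; exact: cf. Qed.

Lemma CkW r U f : Ck r.+1 U f -> Ck r U f.
Proof.
elim: r f => [|r IH] f [cf df]; split => // i.
by split; [exact: (df i).1|exact/IH/(df i).2].
Qed.

(** On an open set, equality on [U] is equality near each of its points and therefore passes to
    partial derivatives of every order. *)
Lemma eq_Ck r U f g : open U -> (forall x, U x -> f x = g x) ->
  Ck r U f -> Ck r U g.
Proof.
move=> oU; have near_eq f' g' : (forall x, U x -> f' x = g' x) ->
    forall x, U x -> {near x, f' =1 g'}.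
  by move=> fg x Ux; near=> y; apply: fg; near: y; exact: open_nbhs_nbhs.
have near_cont f' g' x : (forall x, U x -> f' x = g' x) -> U x ->
    {for x, continuous f'} -> {for x, continuous g'}.
  move=> fg Ux; rewrite /prop_for /continuous_at -fg//.
  by move=> cf; apply: cvg_trans cf; exact: near_eq_cvg (near_eq _ _ fg x Ux).
elim: r f g => [|r IH] f g fg Cf; split => //; try by
    move=> x Ux; exact/(near_cont _ _ _ fg Ux)/Cf.1.
move=> i; have [df Cdf] := Cf.2 i; split.
  by move=> x Ux; apply: near_eq_derivable (df x Ux) => //; exact: near_eq.
apply: (IH _ _ _ Cdf) => x Ux; apply: near_eq_derive => //; exact: near_eq.
Unshelve. all: by end_near. Qed.

Lemma Ck_cst r U (c : R) : Ck r U (fun=> c).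
Proof.
elim: r c => [|r IH] c; split => //; try by move=> x _; exact: cst_continuous.
move=> i; have D x : is_derive (x : 'rV[R]_k) (delta_mx 0 i) (fun _ : 'rV[R]_k => c) 0.
  exact: is_derive_cst.
split; first by move=> x _; exact: ex_derive.
by rewrite (_ : partial i _ = fun=> 0)//; apply/funext => x; exact: derive_val.
Qed.

Lemma CkD r U f g : open U -> Ck r U f -> Ck r U g ->
  Ck r U (fun x => f x + g x).
Proof.
move=> oU; elim: r f g => [|r IH] f g Cf Cg; split => //.
- by move=> x Ux; exact: cvgD (Cf.1 x Ux) (Cg.1 x Ux).
- by move=> x Ux; exact: cvgD (Cf.1 x Ux) (Cg.1 x Ux).
move=> i; have [df Cdf] := Cf.2 i; have [dg Cdg] := Cg.2 i; split.
  by move=> x Ux; apply: derivableD; [exact: df|exact: dg].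
apply: (eq_Ck _ _ _ _ oU _ (IH _ _ Cdf Cdg)) => x Ux.
by rewrite /partial deriveD//; [exact: df|exact: dg].
Qed.

(** Restriction to a line reduces directional derivatives to derivatives at 0 in one real variable,
    where the chain rule of the real line applies. *)
Lemma is_derive_line f x v (d : R) :
  is_derive x v f d <-> is_derive (0 : R) 1 (fun h => f (h *: v + x)) d.
Proof.
have E : (fun h => h^-1 *: ((f \o shift x) (h *: v) - f x)) =
   (fun h => h^-1 *: (((fun h => f (h *: v + x)) \o shift 0) (h *: (1 : R))
      - (fun h => f (h *: v + x)) 0)).
  apply/funext => h /=; rewrite scale0r add0r addr0.
  by rewrite /GRing.scale/= mulr1.
split=> - [d1 d2]; split.
- by rewrite /derivable -E.
- by rewrite -d2 /derive -E.
- by rewrite /derivable E.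
- by rewrite -d2 /derive E.
Qed.

End CkTheory.

(** * Changes of the time coordinate on [R x R^m] *)

Section Warp.
Context {R : realType} {m : nat}.
Implicit Types (z : 'rV[R]_(1 + m)) (U S : set 'rV[R]_(1 + m)).

Lemma timeE z : time z = z 0 (lshift m 0).
Proof. by rewrite /time mxE. Qed.

Lemma spaceE z j : Defs.space z 0 j = z 0 (rshift 1 j).
Proof. by rewrite /Defs.space mxE. Qed.

Lemma time_tx (t : R) (x : 'rV[R]_m) : time (tx t x) = t.
Proof. by rewrite /time /tx row_mxKl mxE eqxx. Qed.

Lemma space_tx (t : R) (x : 'rV[R]_m) : Defs.space (tx t x) = x.
Proof. by rewrite /Defs.space /tx row_mxKr. Qed.

Definition warp (zeta : R -> R) z := tx (zeta (time z)) (Defs.space z).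

Lemma warpE zeta z :
  warp zeta z = (zeta (time z) - time z) *: delta_mx 0 (lshift m 0) + z.
Proof.
apply/rowP => i; rewrite !mxE eqxx /=; case: (splitP i) => j ij.
  have -> : i = lshift m 0 by apply/val_inj; rewrite /= ij ord1.
  by rewrite ord1 mxE eqxx timeE mulr1n mulr1 subrK.
have -> : i = rshift 1 j by exact/val_inj.
by rewrite eq_rlshift mulr0 add0r spaceE.
Qed.

Lemma time_add h i z : time (h *: delta_mx 0 i + z) =
  (if i == lshift m 0 then h else 0) + time z.
Proof.
rewrite !timeE !mxE eqxx /= eq_sym.
by case: eqP => _; rewrite ?mulr1 ?mulr0.
Qed.

(** Each coordinate line goes to a coordinate line of the same direction, and only the time lines
    change speed. Hence a partial derivative of a composite with [warp] involves a single partial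
    derivative of the outer function. *)
Lemma warp_add zeta h i z : warp zeta (h *: delta_mx 0 i + z) =
  (if i == lshift m 0 then zeta (h + time z) - zeta (time z) else h) *:
  delta_mx 0 i + warp zeta z.
Proof.
rewrite !warpE time_add; case: eqP => [->|_].
  by rewrite !addrA -!scalerDl; congr (_ *: _ + _); ring.
by rewrite add0r addrCA.
Qed.

Lemma continuous_time : continuous (@time R m).
Proof.
move=> z; rewrite (_ : time = fun z => z 0 (lshift m 0)).
  exact: coord_continuous.
by apply/funext => y; rewrite timeE.
Qed.

Lemma continuous_warp zeta : continuous zeta -> continuous (warp zeta).
Proof.
move=> cz z; rewrite (_ : warp zeta = fun z =>
   (zeta (time z) - time z) *: delta_mx 0 (lshift m 0) + z).
  have c1 : {for z, continuous (zeta \o time)}.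
    by apply: continuous_comp; [exact: continuous_time|exact: cz].
  exact: cvgD (cvgZ (cvgB c1 (continuous_time z)) (cvg_cst _)) cvg_id.
by apply/funext => y; rewrite warpE.
Qed.

Section CkWarp.
Variable zeta : R -> R.
Hypothesis smooth_zeta : smooth_line zeta.

Lemma is_derive_warp_space (a : R -> R) g i z d : i != lshift m 0 ->
  is_derive (warp zeta z) (delta_mx 0 i) g d ->
  is_derive z (delta_mx 0 i) (fun z => a (time z) * g (warp zeta z))
    (a (time z) * d).
Proof.
move=> /negbTE i0 /is_derive_line dg; apply/is_derive_line.
have E : (fun h => a (time (h *: delta_mx 0 i + z)) *
    g (warp zeta (h *: delta_mx 0 i + z))) =
    fun h => a (time z) *: g (h *: delta_mx 0 i + warp zeta z).
  by apply/funext => h; rewrite time_add warp_add i0 add0r.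
by rewrite E; exact: is_deriveZ.
Qed.

Lemma is_derive_warp_time (a : R -> R) a' g z d :
  is_derive (time z) 1 a a' ->
  is_derive (warp zeta z) (delta_mx 0 (lshift m 0)) g d ->
  is_derive z (delta_mx 0 (lshift m 0)) (fun z => a (time z) * g (warp zeta z))
    (a' * g (warp zeta z) + a (time z) * derive1 zeta (time z) * d).
Proof.
move=> da /is_derive_line dg; apply/is_derive_line.
pose e0 : 'rV[R]_(1 + m) := delta_mx 0 (lshift m 0).
have E : (fun h => a (time (h *: e0 + z)) * g (warp zeta (h *: e0 + z))) =
    fun h => a (h + time z) *
      g ((zeta (h + time z) - zeta (time z)) *: e0 + warp zeta z).
  by apply/funext => h; rewrite time_add warp_add eqxx.
rewrite E.
have dsh : is_derive (0 : R) 1 (fun h => h + time z) 1.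
  by have := is_deriveD (is_derive_id (0 : R) 1) (is_derive_cst (time z) (0 : R) 1);
    rewrite addr0.
have dz : is_derive (0 : R) 1 (fun h => zeta (h + time z) - zeta (time z))
    (derive1 zeta (time z)).
  have dz0 : is_derive (0 + time z) 1 zeta (derive1 zeta (time z)).
    by rewrite add0r; exact: Cline_is_derive (smooth_zeta 1).
  have := is_deriveB (is_derive1_comp (g := fun h => h + time z) (x := 0) dz0 dsh)
    (is_derive_cst (zeta (time z)) (0 : R) 1).
  by rewrite mulr1 subr0.
have dg' : is_derive (zeta (0 + time z) - zeta (time z)) 1
   (fun h => g (h *: e0 + warp zeta z)) d.
  by rewrite add0r subrr.
have da0 : is_derive (0 + time z) 1 a a' by rewrite add0r.
have := is_deriveM (is_derive1_comp (g := fun h => h + time z) (x := 0) da0 dsh)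
  (is_derive1_comp (g := fun h => zeta (h + time z) - zeta (time z)) (x := 0) dg' dz).
move=> D; apply: is_derive_eq D _.
rewrite /= !add0r subrr scale0r add0r mulr1.
rewrite -[LHS]/(_ * _ + _ * _); ring.
Qed.

(** The factor [a] closes the class under differentiation: the time derivative of [a * (g o warp)]
    is [a' * (g o warp) + (a zeta') * (partial g o warp)], a sum of two functions of the same form,
    and a space derivative only replaces [g]. *)
Lemma Ck_warp r U (a : R -> R) g : open U -> Cline r a -> Ck r U g ->
  Ck r (warp zeta @^-1` U) (fun z => a (time z) * g (warp zeta z)).
Proof.
move=> oU; have cw := continuous_warp _ (Cline_continuous _ _ (smooth_zeta 0)).
have oV : open (warp zeta @^-1` U) by apply: open_comp => // ? _; exact: cw.
have cont r' a' g' z : Cline r' a' -> Ck r' U g' -> (warp zeta @^-1` U) z ->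
    {for z, continuous (fun z => a' (time z) * g' (warp zeta z))}.
  move=> Ca Cg Uz.
  have ca : {for z, continuous (a' \o time)}.
    by apply: continuous_comp; [exact: continuous_time|exact: Cline_continuous Ca _].
  have cg : {for z, continuous (g' \o warp zeta)}.
    by apply: continuous_comp; [exact: cw|exact: Ck_continuous Cg Uz].
  exact: cvgM ca cg.
elim: r a g => [|r IH] a g Ca Cg; split => //; try by move=> z; exact: cont Ca Cg.
move=> i; have [dg Cdg] := Cg.2 i.
have dgE z : (warp zeta @^-1` U) z ->
    is_derive (warp zeta z) (delta_mx 0 i) g (partial i g (warp zeta z)).
  by move=> Uz; split => //; exact: dg.
have [i0|i0] := eqVneq i (lshift m 0); last first.
  have D z Uz := is_derive_warp_space a _ _ z _ i0 (dgE z Uz).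
  split; first by move=> z Uz; have ? := D z Uz; exact: ex_derive.
  apply: (eq_Ck _ _ _ _ oV _ (IH _ _ (ClineW _ _ Ca) Cdg)) => z Uz.
  by rewrite /partial; have ? := D z Uz; rewrite derive_val.
subst i.
have D z Uz :=
  is_derive_warp_time _ _ _ z _ (Cline_is_derive _ _ (time z) Ca) (dgE z Uz).
split; first by move=> z Uz; have ? := D z Uz; exact: ex_derive.
apply: (eq_Ck _ _ _ _ oV _ (CkD _ _ _ _ oV (IH _ _ Ca.2 (CkW _ _ _ Cg))
  (IH _ _ (ClineM _ _ _ (ClineW _ _ Ca) (smooth_zeta r.+1).2) Cdg))) => z Uz.
by rewrite /partial; have ? := D z Uz; rewrite derive_val.
Qed.

(** A local extension of [f] composed with [warp] is a local extension of the composite. The factor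
    will be [zeta'] for Hamiltonians and 1 for isotopies. *)
Lemma smooth_in_warp S (a : R -> R) f : smooth_line a -> smooth_in S f ->
  smooth_in (warp zeta @^-1` S) (fun z => a (time z) * f (warp zeta z)).
Proof.
move=> sa sf z /= Sz; have [U [g [oU Uz sg gf]]] := sf _ Sz.
exists (warp zeta @^-1` U), (fun z => a (time z) * g (warp zeta z)).
split => //.
- apply: open_comp => // ? _; apply: continuous_warp.
  exact: Cline_continuous _ _ (smooth_zeta 0).
- by move=> r; apply: Ck_warp.
- by move=> y Uy Sy; rewrite gf.
Qed.

End CkWarp.

End Warp.

Lemma smooth_in_sub {R : realType} {k : nat} (S S' : set 'rV[R]_k) f f' :
  S' `<=` S -> (forall x, S' x -> f x = f' x) -> smooth_in S f -> smooth_in S' f'.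
Proof.
move=> SS ff sf x Sx; have [U [g [oU Ux sg gf]]] := sf _ (SS _ Sx).
exists U, g; split => // y Uy Sy; rewrite gf//; [exact: ff|exact: SS].
Qed.

(** The line is viewed as time together with a point of [R^0]: this is [smooth_in_warp] for the
    identity change of time and the constant function 1, with [a] as the factor. *)
Lemma smooth_line_smooth01 {R : realType} (a : R -> R) : smooth_line a -> smooth01 a.
Proof.
move=> sa.
have s1 : smooth_in [set: 'rV[R]_(1 + 0)] (fun=> 1).
  move=> x _; exists setT, (fun=> 1); split => //; first exact: openT.
  by move=> r; exact: Ck_cst.
apply: smooth_in_sub (smooth_in_warp _ smooth_line_id _ _ _ sa s1) => // z _.
by rewrite mulr1 timeE; congr (a (z _ _)); exact/val_inj.
Qed.

(** * Dependence of the norm on time *)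

Section JointContinuity.
Context {R : realType}.

Lemma continuous_tx {m} : continuous (fun p : R * 'rV[R]_m => tx p.1 p.2).
Proof.
move=> [t0 x0]; apply/cvg_ballP => e e0 /=.
near=> p; split => // i j; rewrite !ord1 /=.
have bt : ball t0 e p.1.
  by near: p; apply: (@cvg_fst _ _ (nbhs t0) (nbhs x0)); exact: nbhsx_ballx.
have bx : ball x0 e p.2.
  by near: p; apply: (@cvg_snd _ _ (nbhs t0) (nbhs x0)); exact: nbhsx_ballx.
rewrite /tx; case: (splitP j) => k jk.
  have -> : j = lshift m 0 by apply/val_inj; rewrite /= jk ord1.
  by rewrite !row_mxEl !mxE eqxx.
have -> : j = rshift 1 k by exact/val_inj.
by rewrite !row_mxEr; exact: bx.2.
Unshelve. all: by end_near. Qed.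

Context {M : ptopologicalType} {m : nat} (A : smooth_atlas R M m).

Lemma smooth_tfun_continuous (H : R -> M -> R) : smooth_tfun A H ->
  {within I01 `*` setT, continuous (fun p => H p.1 p.2)}.
Proof.
move=> sH; apply/subspace_continuousP => -[t0 x0] [/= It0 _].
have [c Ac cx0] := charts_cover A x0.
have Sz : [set z | I01 (time z) /\ ran c (Defs.space z)] (tx t0 (c x0)).
  by rewrite /= time_tx space_tx; split => //; exists x0.
have [U [G [oU Uz sG GE]]] := sH c Ac _ Sz.
have cc : {for x0, continuous c}.
  have := fwd_continuous (c := c).
  by rewrite continuous_open_subspace; [apply; rewrite inE|exact: dom_open].
have ctx : {for (t0, x0), continuous (fun p : R * M => tx p.1 (c p.2))}.
  have cs : c p.2 @[p --> (t0, x0)] --> c x0.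
    exact: (cvg_comp (snd : R * M -> M) c cvg_snd cc).
  have cp : (p.1, c p.2) @[p --> (t0, x0)] --> (t0, c x0).
    exact: (@cvg_pair _ _ _ (nbhs (t0, x0)) (nbhs t0) (nbhs (c x0)) _ _ _
      fst (fun p => c p.2) cvg_fst cs).
  exact: (cvg_comp (fun p : R * M => (p.1, c p.2))
    (fun q : R * 'rV[R]_m => tx q.1 q.2) cp (continuous_tx (t0, c x0))).
have cG : (fun p : R * M => G (tx p.1 (c p.2))) @ (t0, x0) --> H t0 x0.
  have -> : H t0 x0 = G (tx t0 (c x0)).
    by rewrite GE// time_tx space_tx fwdK.
  exact: (cvg_comp (fun p : R * M => tx p.1 (c p.2)) G ctx
    (Ck_continuous _ _ _ _ (sG 0%N) Uz)).
apply: (cvg_trans _ (cvg_within_filter _ cG)).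
apply: near_eq_cvg; rewrite near_withinE; near=> p => -[Ip _].
have cp : dom c p.2.
  near: p; apply: (@cvg_snd _ _ (nbhs t0) (nbhs x0)).
  by apply: open_nbhs_nbhs; split => //; exact: dom_open.
have Up : U (tx p.1 (c p.2)).
  by near: p; apply: ctx; exact: open_nbhs_nbhs.
rewrite GE//; first by rewrite time_tx space_tx fwdK.
by rewrite /= time_tx space_tx; split => //; exists p.2.
Unshelve. all: by end_near. Qed.

Hypothesis compM : compact [set: M].
Variable H : R -> M -> R.
Hypothesis cH : {within I01 `*` setT, continuous (fun p => H p.1 p.2)}.

Lemma slice_continuous t : I01 t -> continuous (H t).
Proof.
move=> It x; have /subspace_continuousP/(_ (t, x) (conj It I)) := cH.
move=> /cvgrPdist_lt ct; apply/cvgrPdist_lt => e e0.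
have := ct e e0; rewrite near_withinE => -[[/= P Q] [Pt Qx] PQ].
near=> y; apply: (PQ (t, y)) => //; split => /=; first exact: nbhs_singleton.
by near: y.
Unshelve. all: by end_near. Qed.

(** Tube argument: joint continuity at every [(t0, x)] becomes uniform in [x] by compactness of
    [M]. *)
Lemma slice_unif_continuous t0 e : I01 t0 -> 0 < e ->
  \forall t \near within I01 (nbhs t0), forall x, `|H t0 x - H t x| < e.
Proof.
move=> It0 e0; rewrite near_withinE.
have /compact_near_coveringP cov := compM.
have /= := cov _ (nbhs t0) (fun t x => I01 t -> `|H t0 x - H t x| < e) _ _.
move=> h; near=> t => It x; move: x (I : [set: M] x) It; near: t; apply: h => x _.
have /subspace_continuousP/(_ (t0, x) (conj It0 I)) := cH.
move=> /cvgrPdist_lt/(_ (e / 2)); rewrite divr_gt0// => /(_ isT).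
rewrite near_withinE => -[[/= P Q] [Pt Qx] PQ].
near=> y t => It.
have := PQ (t, y); have := PQ (t0, y); rewrite /= => h0 h1.
have {}h0 : `|H t0 x - H t0 y| < e / 2.
  apply: h0 => //; split => /=; first exact: nbhs_singleton.
  by near: y.
have {}h1 : `|H t0 x - H t y| < e / 2.
  by apply: h1 => //; split => /=; [near: t|near: y].
have := ler_distD (H t0 x) (H t0 y) (H t y); rewrite (distrC (H t0 y) (H t0 x)).
lra.
Unshelve. all: by end_near. Qed.

End JointContinuity.

(** * Estimates for the norm of a function on [M] *)

Section HamNorm.
Context {R : realType} {M : ptopologicalType}.
Variable mu : {measure set (borel_type (M := M)) -> \bar R}.
Hypothesis compM : compact [set: M].
Implicit Types u v : M -> R.

Lemma continuous_image_bounds u : continuous u ->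
  has_ubound (range u) /\ has_lbound (range u).
Proof.
move=> cu; have ne : [set: M] !=set0 by exists point.
have cu' := continuous_subspaceT (A := setT) cu.
have [x _ xP] := compact_EVT_max ne compM cu'.
have [y _ yP] := compact_EVT_min ne compM cu'.
split; [exists (u x)|exists (u y)] => _ [z _ <-]; [apply: xP|apply: yP];
  by rewrite inE.
Qed.

Lemma continuous_borel_measurable u : continuous u ->
  measurable_fun [set: borel_type (M := M)] u.
Proof.
move=> cu; apply: (measurability _ (measurable_realfun.RGenOpens.measurableE R)).
move=> _ [_ [a [b ->] <-]]; rewrite setTI; apply: sub_gen_smallest.
by apply: open_comp; [move=> x _; exact: cu|exact: interval_open].
Qed.

Lemma continuous_borel_integrable u : (mu [set: M] < +oo)%E -> continuous u ->
  mu.-integrable [set: borel_type (M := M)] (EFin \o u).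
Proof.
move=> fmu cu; apply: measurable_bounded_integrable => //.
  exact: continuous_borel_measurable.
have /compact_bounded[K [_ KP]] :=
  continuous_compact (continuous_subspaceT (A := setT) cu) compM.
by exists K; split; rewrite ?num_real// => r Kr x _; apply: KP => //; exists x.
Qed.

Lemma fine_measureT_ge0 : 0 <= fine (mu [set: M]).
Proof. exact: fine_ge0. Qed.

(* If [mu] is infinite then [mean mu] vanishes identically, because
   [fine +oo = 0] and [0^-1 = 0]. *)
Lemma mean_infinite u : ~~ (mu [set: M] < +oo)%E -> mean mu u = 0.
Proof. by rewrite -leNgt leye_eq /mean => /eqP ->; rewrite /= invr0 mul0r. Qed.

Lemma ler_meanB u v e : continuous u -> continuous v ->
  (forall x, `|u x - v x| <= e) -> `|mean mu u - mean mu v| <= e.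
Proof.
move=> cu cv uve; have e0 : 0 <= e := le_trans (normr_ge0 _) (uve point).
have [fmu|imu] := boolP (mu [set: M] < +oo)%E; last first.
  by rewrite !mean_infinite// subrr normr0.
have iu := continuous_borel_integrable _ fmu cu.
have iv := continuous_borel_integrable _ fmu cv.
have cuv : continuous (fun x => u x - v x) by move=> x; exact: cvgB (cu x) (cv x).
have iuv := continuous_borel_integrable _ fmu cuv.
rewrite /mean -mulrBr -RintegralB// normrM ger0_norm ?invr_ge0 ?fine_measureT_ge0//.
have m0 := fine_measureT_ge0.
have : `|\int[mu]_(x in [set: M]) (u x - v x)| <= e * fine (mu [set: M]).
  apply: le_trans (le_normr_Rintegral _ iuv) _ => //.
  rewrite -Rintegral_cst//; apply: le_Rintegral => //.
  - apply: continuous_borel_integrable => // x.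
    exact: cvg_norm (cuv x).
  - by apply: continuous_borel_integrable => // x; exact: cst_continuous.
(* If the total mass is 0, its inverse is 0 by convention and the bound is trivial. *)
move: m0; rewrite le_eqVlt => /predU1P[<- _|m0]; first by rewrite invr0 mul0r.
by rewrite ler_pdivrMl// [fine _ * e]mulrC.
Qed.

Lemma meanZ c u : continuous u -> mean mu (fun x => c * u x) = c * mean mu u.
Proof.
move=> cu; have [fmu|imu] := boolP (mu [set: M] < +oo)%E; last first.
  by rewrite !mean_infinite// mulr0.
have iu := continuous_borel_integrable _ fmu cu.
by rewrite /mean RintegralZl// mulrCA.
Qed.

Lemma ham_norm_ge0 u : continuous u -> 0 <= ham_norm mu u.
Proof.
move=> /continuous_image_bounds[ub lb]; rewrite addr_ge0// subr_ge0.
by apply: (@le_trans _ _ (u point)); [apply: ge_inf|apply: ub_le_sup].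
Qed.

Lemma ler_ham_normZ c u : 0 <= c -> continuous u ->
  ham_norm mu (fun x => c * u x) <= c * ham_norm mu u.
Proof.
move=> c0 cu; have [ub lb] := continuous_image_bounds _ cu.
rewrite /ham_norm meanZ// normrM (ger0_norm c0) mulrDr lerD2r mulrBr.
rewrite lerB//.
  apply: ge_sup; first by exists (c * u point), point.
  by move=> _ [x _ <-]; rewrite ler_wpM2l//; apply: ub_le_sup => //; exists x.
apply: lb_le_inf; first by exists (c * u point), point.
by move=> _ [x _ <-]; rewrite ler_wpM2l//; apply: ge_inf => //; exists x.
Qed.

(** The maximum, the minimum and the mean each change by at most [e], whence the factor 3. *)
Lemma ler_ham_normD u v e : continuous u -> continuous v ->
  (forall x, `|u x - v x| <= e) -> ham_norm mu u <= ham_norm mu v + 3 * e.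
Proof.
move=> cu cv uve; have [ub lb] := continuous_image_bounds _ cu.
have [vb wb] := continuous_image_bounds _ cv.
have s1 : sup (range u) <= sup (range v) + e.
  apply: ge_sup; first by exists (u point), point.
  move=> _ [x _ <-]; have := ub_le_sup vb (imageP v (I : [set: M] x)).
  by have := uve x; rewrite ler_norml => /andP[]; lra.
have s2 : inf (range v) <= inf (range u) + e.
  rewrite -lerBlDr; apply: lb_le_inf; first by exists (u point), point.
  move=> _ [x _ <-]; have := ge_inf wb (imageP v (I : [set: M] x)).
  by have := uve x; rewrite ler_norml => /andP[]; lra.
have := ler_meanB _ _ _ cu cv uve.
have := ler_normD (mean mu u - mean mu v) (mean mu v); rewrite subrK.
rewrite /ham_norm; lra.
Qed.

Lemma ham_norm_continuous (H : R -> M -> R) :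
  {within I01 `*` setT, continuous (fun p => H p.1 p.2)} ->
  {within I01, continuous (fun t => ham_norm mu (H t))}.
Proof.
move=> cH; apply/subspace_continuousP => t0 It0; apply/cvgrPdist_lt => e e0.
(* The norm then varies by at most [3 e / 4], strictly less than [e]. *)
have e4 : 0 < e / 4 by rewrite divr_gt0.
have := slice_unif_continuous compM _ cH t0 _ It0 e4.
rewrite !near_withinE; apply: filterS => t h It.
have c0 := slice_continuous _ cH _ It0; have c1 := slice_continuous _ cH _ It.
have := ler_ham_normD _ _ _ c0 c1 (fun x => ltW (h It x)).
have := ler_ham_normD _ _ (e / 4) c1 c0.
have d x : `|H t x - H t0 x| <= e / 4 by rewrite distrC ltW// h.
move=> /(_ d) h1 h2; rewrite /from_subspace/= ltr_norml; apply/andP; split; lra.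
Qed.

End HamNorm.

(** * Reparametrised isotopies *)

Section Reparametrisation.
Context {R : realType}.
Variable zeta : R -> R.
Hypothesis zeta_derivable : forall t : R, derivable zeta t 1.

(** Every point of [[0, 1]] is an accumulation point of it, so limits of difference quotients within
    [[0, 1]] are unique. A nearby point is found to the right of [t] when [t <= 1 / 2] and to the
    left otherwise, a step of at most [1 / 2] staying in the interval. *)
Lemma within_I01_proper (t : R) : I01 t -> ProperFilter (within I01 t^').
Proof.
rewrite /I01/= in_itv/= => /andP[t0 t1].
split; last exact: within_filter.
move=> /nbhs_ballP[e /= e0 he].
have [th|th] := leP t 2^-1.
- apply: (he (t + Num.min (e / 2) 2^-1)).
  + rewrite /ball/= opprD addNKr normrN gtr0_norm ?lt_min ?gt_min; last lra.
    by apply/orP; left; lra.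
  + by rewrite -subr_eq0 addrAC subrr add0r gt_eqF// lt_min; lra.
  + rewrite in_itv/=; have : Num.min (e / 2) 2^-1 <= 2^-1 by rewrite ge_min lexx orbT.
    have : 0 < Num.min (e / 2) 2^-1 by rewrite lt_min; lra.
    by move=> *; lra.
- apply: (he (t - Num.min (e / 2) 2^-1)).
  + rewrite /ball/= opprB addrC subrK gtr0_norm ?lt_min ?gt_min; last lra.
    by apply/orP; left; lra.
  + by rewrite -subr_eq0 addrAC subrr add0r oppr_eq0 gt_eqF// lt_min; lra.
  + rewrite in_itv/=; have : Num.min (e / 2) 2^-1 <= 2^-1 by rewrite ge_min lexx orbT.
    have : 0 < Num.min (e / 2) 2^-1 by rewrite lt_min; lra.
    by move=> *; lra.
Qed.

Lemma derivable_factor (t : R) : exists q : R -> R,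
  [/\ forall s, zeta s - zeta t = q s * (s - t),
      q s @[s --> within I01 t^'] --> derive1 zeta t & q t = derive1 zeta t].
Proof.
have : is_derive t 1 zeta (derive1 zeta t) by apply: DeriveDef; rewrite ?derive1E.
move=> /is_derive1_caratheodory[q [qE cq qt]]; exists q; split => //.
by rewrite -qt; apply: cvg_within_filter; apply: cvg_within_filter.
Qed.

Lemma derive01E t : I01 t -> derive01 zeta t = derive1 zeta t.
Proof.
move=> It; have PF := within_I01_proper t It; have [q [qE cq qt]] := derivable_factor t.
apply: cvg_lim => //; apply: cvg_trans cq; apply: near_eq_cvg.
rewrite !near_withinE; near=> s => st _.
by rewrite qE /GRing.scale/= mulrC mulfK// subr_eq0.
Unshelve. all: by end_near. Qed.

Hypothesis zeta_incr : forall s t, s < t -> zeta s < zeta t.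
Hypothesis zeta_I01 : forall t, I01 t -> I01 (zeta t).

(** Strict monotonicity sends punctured neighbourhoods of [t] into punctured neighbourhoods of
    [zeta t], so the quotient of the composite is the Caratheodory slope [q] of [zeta] times the
    quotient of [f], and both factors converge within [[0, 1]]. *)
Lemma is_derive01_comp (V : normedModType R) (f : R -> V) t v :
  is_derive01 f (zeta t) v ->
  is_derive01 (fun s => f (zeta s)) t (derive1 zeta t *: v).
Proof.
move=> df; have [q [qE cq qt]] := derivable_factor t.
have zN s : s != t -> zeta s != zeta t.
  by rewrite !neq_lt => /orP[/zeta_incr->//|/zeta_incr ->]; rewrite orbT.
have cz : zeta s @[s --> within I01 t^'] --> within I01 (zeta t)^'.
  have cz : {for t, continuous zeta}.
    exact: (is_derive1_continuous _ _ (fun s => derivableP (zeta_derivable s))).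
  move=> P nP; have {}nP : \forall y \near zeta t, y != zeta t -> I01 y -> P y := nP.
  suff : \forall s \near t, s != t -> I01 s -> P (zeta s) by [].
  have : \forall s \near t, zeta s != zeta t -> I01 (zeta s) -> P (zeta s) := cz _ nP.
  by apply: filterS => s Ps st Is; apply: Ps; [exact: zN|exact: zeta_I01].
have FF : Filter (within I01 t^') := within_filter _ _.
have cqf : q s *: ((zeta s - zeta t)^-1 *: (f (zeta s) - f (zeta t)))
    @[s --> within I01 t^'] --> derive1 zeta t *: v.
  exact: (cvgZ cq (cvg_comp zeta _ cz df)).
apply: cvg_trans cqf; apply: near_eq_cvg.
rewrite !near_withinE; near=> s => st _.
have zst : zeta s - zeta t != 0 by rewrite subr_eq0 zN.
rewrite /= scalerA; congr (_ *: _); rewrite qE invfM mulrA divff ?mul1r//.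
by move: zst; rewrite qE mulf_eq0 negb_or => /andP[].
Unshelve. all: by end_near. Qed.

End Reparametrisation.

Section ReparamIsotopy.
Context {R : realType} {M : ptopologicalType}.
Variable zeta : R -> R.
Hypothesis smooth_zeta : smooth_line zeta.
Hypothesis zeta_I01 : forall t, I01 t -> I01 (zeta t).

Section SmoothReparam.
Context {m : nat} (A : smooth_atlas R M m).

Lemma smooth_tfun_reparam_ham (H : R -> M -> R) :
  smooth_tfun A H -> smooth_tfun A (reparam_ham zeta H).
Proof.
move=> sH c Ac; have zd := (smooth_zeta 1).1.
have sz' : smooth_line (derive1 zeta) by move=> r; exact: (smooth_zeta r.+1).2.
apply: (smooth_in_sub _ _ _ _ _ _
  (smooth_in_warp _ smooth_zeta _ _ _ sz' (sH c Ac))).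
  by move=> z [/= Iz cz]; rewrite /warp time_tx space_tx; split => //; exact: zeta_I01.
by move=> z [Iz _]; rewrite /warp time_tx space_tx /reparam_ham derive01E.
Qed.

Lemma smooth_tmap_reparam (Phi : R -> M -> M) :
  smooth_tmap A Phi -> smooth_tmap A (reparam zeta Phi).
Proof.
move=> [cPhi sPhi]; split.
  apply/subspace_continuousP => -[t x] [/= It _].
  have cPhitx : Phi p.1 p.2 @[p --> within (I01 `*` setT) (nbhs (zeta t, x))]
      --> Phi (zeta t) x.
    move/subspace_continuousP : cPhi => /(_ (zeta t, x)); apply.
    by split => //; exact: zeta_I01.
  have cz : (zeta p.1, p.2) @[p --> within (I01 `*` setT) (nbhs (t, x))] -->
      within (I01 `*` [set: M]) (nbhs (zeta t, x)).
    move=> P [[/= P1 P2] [nP1 nP2] PP].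
    exists (zeta @^-1` P1, P2) => /=.
      by split => //; exact: (Cline_continuous _ _ (smooth_zeta 0)).
    move=> [s y] [/= Ps Py] [/= Is _].
    by apply: (PP (zeta s, y)) => //; split => //; exact: zeta_I01.
  exact: (cvg_comp (fun p : R * M => (zeta p.1, p.2)) (fun p => Phi p.1 p.2) cz cPhitx).
move=> c c' Ac Ac' j.
apply: (smooth_in_sub _ _ _ _ _ _
  (smooth_in_warp _ smooth_zeta _ _ _ (smooth_line_cst 1) (sPhi c c' Ac Ac' j))).
  move=> z [/= Iz cz dz]; rewrite /warp/tlocal_dom/= time_tx space_tx.
  by split => //; exact: zeta_I01.
by move=> z _; rewrite mul1r /tlocal_rep /warp time_tx space_tx.
Qed.

End SmoothReparam.

Context {n : nat} {A : smooth_atlas R M (1 + n * 2)} (alpha : one_form A).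

Lemma contact_isotopy_reparam (Phi : R -> M -> M) :
  contact_isotopy alpha Phi -> contact_isotopy alpha (reparam zeta Phi).
Proof.
by move=> [sPhi cPhi]; split; [exact: smooth_tmap_reparam|move=> t /zeta_I01/cPhi].
Qed.

Lemma conformal_factor_reparam (Phi : R -> M -> M) (h : R -> M -> R) :
  conformal_factor alpha Phi h ->
  conformal_factor alpha (reparam zeta Phi) (reparam zeta h).
Proof. by move=> hh t /zeta_I01/hh. Qed.

(** The generating field is [zeta'(t) X_zeta(t)], and pairing with [alpha] is linear. *)
Lemma generates_reparam (H : R -> M -> R) (Phi : R -> M -> M) :
  (forall s t, s < t -> zeta s < zeta t) -> generates alpha H Phi ->
  generates alpha (reparam_ham zeta H) (reparam zeta Phi).
Proof.
move=> incr [X [XPhi XH]]; have zd := (smooth_zeta 1).1.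
exists (fun t c y => derive1 zeta t *: X (zeta t) c y); split => t It.
  move=> x c Ac cx; apply: (is_derive01_comp zeta zd incr zeta_I01 _
    (fun s => c (Phi s x))).
  by apply: XPhi => //; exact: zeta_I01.
move=> y c Ac cy; rewrite /reparam_ham derive01E// (XH _ (zeta_I01 _ It) _ _ Ac cy).
by rewrite /pairing -scalemxAl [RHS]mxE.
Qed.

End ReparamIsotopy.

Lemma image_reparam {R : realType} {T : Type} (zeta : R -> R) (E : R -> T) :
  continuous zeta -> zeta 0 = 0 -> zeta 1 = 1 ->
  (forall t, I01 t -> I01 (zeta t)) ->
  [set E (zeta t) | t in I01] = [set E t | t in I01].
Proof.
move=> cz z0 z1 zI; apply/seteqP; split => _ [t It <-].
  by exists (zeta t) => //; exact: zI.
have [||s Is <-] := @IVT R zeta 0 1 t ler01; last by exists s.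
- exact: continuous_subspaceT.
- rewrite z0 z1; move: It; rewrite /I01/= in_itv/= ge_min le_max.
  by move=> /andP[-> ->]; rewrite orbT.
Qed.

(** * Isotopies compared with themselves: neighbourhoods and distances *)

Section CooNbhs.
Context {R : realType} {M : ptopologicalType} {m : nat} (A : smooth_atlas R M m).

Lemma partials_cst0 {k} (s : seq 'I_k) (x : 'rV[R]_k) :
  partials s (fun=> 0 : R) x = 0.
Proof.
have -> : partials s (fun=> 0) = fun=> 0 :> R; last by [].
elim: s => //= i s ->; apply/funext => y; exact: derive_cst.
Qed.

(** Induction on the generation of neighbourhoods. For a basic one, the difference of local
    representatives vanishes and extends by the zero function; for enlargements, smoothness of [Phi]
    is what gives access to the inclusion. *)
Lemma Coo_nbhs_refl (Phi : R -> M -> M) N :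
  smooth_tmap A Phi -> Coo_nbhs A Phi N -> N Phi.
Proof.
move=> sPhi; elim => {N}; last 2 first.
- by move=> N N' _ NPhi _ N'Phi; split.
- by move=> N N' _ NPhi NN'; exact: NN'.
move=> c c' K r d Ac Ac' cK KI d0 t x /KI [/= It cx c'x]; split => // j.
exists setT, (fun=> 0); split => //; first exact: openT.
- by move=> s; exact: Ck_cst.
- by move=> y _ _; rewrite subrr.
- by move=> s _; rewrite partials_cst0 normr0.
Qed.

End CooNbhs.

Lemma image_cst0 {R : realType} {T : Type} (D : set T) (E : T -> R) : D !=set0 ->
  (forall x, D x -> E x = 0) -> [set E x | x in D] = [set 0].
Proof.
move=> [x0 Dx0] E0; apply/seteqP; split => [_ [x Dx <-]|_ ->]; first by rewrite E0.
by exists x0; rewrite ?E0.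
Qed.

Lemma I01_nonempty {R : realType} : (I01 : set R) !=set0.
Proof. by exists 0; rewrite /I01/= in_itv/= lexx ler01. Qed.

Section SelfDistance.
Context {R : realType} {M : ptopologicalType} {m : nat} {A : smooth_atlas R M m}.
Variable g : riemannian_metric A.

(** Provides the lower bound for the infimum in [dist]; the empty concatenation attains it at equal
    end points. *)
Lemma path_length_ge0 x y l : path_length g x y l -> 0 <= l.
Proof.
elim=> {x y l} [//|gamma z l l' sg [speed [sP ->]] _ l'0].
apply: addr_ge0 => //; apply: Rintegral_ge0 => t It.
have [c Ac cx] := charts_cover A (gamma t).
by have [v _ ->] := sP t It c Ac cx; exact: sqrtr_ge0.
Qed.

Lemma dist_refl x : dist g x x = 0.
Proof.
have ne : [set l | path_length g x x l] !=set0.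
  by exists 0; exact: path_length_nil.
have lb : lbound [set l | path_length g x x l] 0.
  by move=> l /path_length_ge0.
apply/eqP; rewrite eq_le lb_le_inf// andbT.
by apply: ge_inf; [exists 0|exact: path_length_nil].
Qed.

Lemma dbar_refl phi : dbar g phi phi = 0.
Proof.
have ne : [set: M] !=set0 by exists point.
by rewrite /dbar !image_cst0 ?sup1 ?addr0// => x _; exact: dist_refl.
Qed.

Lemma dbar_iso_refl Phi : dbar_iso g Phi Phi = 0.
Proof.
rewrite /dbar_iso image_cst0 ?sup1//; first exact: I01_nonempty.
by move=> t _; exact: dbar_refl.
Qed.

End SelfDistance.

Section ContactDistance.
Context {R : realType} {M : ptopologicalType} {n : nat}.
Context {A : smooth_atlas R M (1 + n * 2)}.
Variable g : riemannian_metric A.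
Variable mu : {measure set (borel_type (M := M)) -> \bar R}.

Lemma conf_norm0 (h : R -> M -> R) : (forall t x, I01 t -> h t x = 0) ->
  conf_norm h = 0.
Proof.
move=> h0; rewrite /conf_norm image_cst0 ?sup1//.
  by have [t It] := @I01_nonempty R; exists (t, point).
by move=> [t x] [/= It _]; rewrite h0// normr0.
Qed.

Lemma ham_norm0 : ham_norm mu (fun=> 0) = 0.
Proof.
have ne : [set: M] !=set0 by exists point.
rewrite /ham_norm image_cst0// sup1 inf1 subrr add0r /mean Rintegral_cst//.
by rewrite mul0r mulr0 normr0.
Qed.

Lemma norm_1oo0 (H : R -> M -> R) : (forall t x, I01 t -> H t x = 0) ->
  norm_1oo mu H = 0.
Proof.
move=> H0; rewrite /norm_1oo (@eq_Rintegral _ _ _ _ _ (fun=> 0)); last first.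
  move=> t; rewrite inE => It; rewrite (_ : H t = fun=> 0) ?ham_norm0//.
  by apply/funext => x; exact: H0.
by rewrite Rintegral_cst ?mul0r//; exact: measurable_I01.
Qed.

Lemma contact_dist_reparam_id (Phi : R -> M -> M) (H h : R -> M -> R) :
  contact_dist mu g Phi H h (reparam id Phi) (reparam_ham id H) (reparam id h) = 0.
Proof.
rewrite /contact_dist dbar_iso_refl conf_norm0 ?norm_1oo0 ?addr0//.
  move=> t x It; rewrite /reparam_ham derive01E//.
  by rewrite derive1E derive_id mul1r subrr.
by move=> t x It; rewrite subrr.
Qed.

Lemma norm_1oo_le_norm_oo (H : R -> M -> R) : compact [set: M] ->
  smooth_tfun A H -> norm_1oo mu H <= norm_oo mu H.
Proof.
move=> cM sH; have cH := ham_norm_continuous mu cM _ (smooth_tfun_continuous A H sH).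
(* Boundedness makes the supremum in [norm_oo] an actual upper bound. *)
have [K K0 KP] := within_I01_bounded _ cH.
have -> : norm_oo mu H = \int[lebesgue_measure]_(t in (I01 : set R)) norm_oo mu H.
  by rewrite Rintegral_I01_cst.
apply: le_Rintegral.
- exact: measurable_I01.
- exact: within_I01_integrable.
- exact/within_I01_integrable/continuous_subspaceT/cst_continuous.
move=> t It; apply: ub_le_sup; last by exists t.
exists K => _ [s Is <-]; exact: le_trans (ler_norm _) (KP s Is).
Qed.

End ContactDistance.

(** The two smallness conditions are prescribed in advance by [delta] and [N]; [N] selects a
    neighbourhood of every contact isotopy, because the isotopy to be approximated is only found in
    the course of the proof. *)
Theorem lemma8p3 (R : realType) (n : nat) (M : ptopologicalType)
  (A : smooth_atlas R M (1 + n * 2)) (hM : closed_connected (M := M))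
  (alpha : one_form A) (halpha : contact_form alpha)
  (mu : {measure set (borel_type (M := M)) -> \bar R})
  (hmu : volume_measure alpha mu)
  (g : riemannian_metric A)
  (H : R -> M -> R) (PhiH : R -> M -> M) (h : R -> M -> R) (eps : R)
  (hH : smooth_tfun A H) (hPhiH : contact_isotopy alpha PhiH)
  (hgen : generates alpha H PhiH) (hh : conformal_factor alpha PhiH h)
  (heps : 0 < eps)
  (delta : R) (hdelta : 0 < delta)
  (N : (R -> M -> M) -> set (R -> M -> M))
  (hN : forall Phi, contact_isotopy alpha Phi -> Coo_nbhs A Phi (N Phi)) :
  exists (F : R -> M -> R) (PhiF : R -> M -> M) (f : R -> M -> R),
    [/\ smooth_tfun A F, contact_isotopy alpha PhiF,
        generates alpha F PhiF & conformal_factor alpha PhiF f] /\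
    (exists zeta eta : R -> R,
       [/\ reparam_fun zeta, reparam_fun eta,
           contact_dist mu g
             (reparam zeta PhiH) (reparam_ham zeta H) (reparam zeta h)
             (reparam eta (reparam zeta PhiH))
             (reparam_ham eta (reparam_ham zeta H))
             (reparam eta (reparam zeta h)) < delta &
           N (reparam eta (reparam zeta PhiH)) PhiF]) /\
    [/\ PhiF 0 = PhiH 0 /\ PhiF 1 = PhiH 1,
        norm_1oo mu F <= norm_oo mu F /\ norm_oo mu F < norm_1oo mu H + eps,
        dbar_iso g PhiF (fun=> PhiF 0) < dbar_iso g PhiH (fun=> PhiH 0) + eps &
        conf_norm (fun t x => f t x - f 0 x) <
          conf_norm (fun t x => h t x - h 0 x) + eps].
Proof.
have [_ compM _] := hM.
have cH := ham_norm_continuous mu compM _ (smooth_tfun_continuous A H hH).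
have nH t : I01 t -> 0 <= ham_norm mu (H t).
  move=> It; apply: ham_norm_ge0 compM _ _.
  exact: slice_continuous (smooth_tfun_continuous A H hH) _ It.
(* Half of [eps] is kept back, since passing to the supremum over time preserves only a weak
   inequality. *)
have [zeta [[sz z0 z1] zd z'0 zP]] := exists_reparam _ (eps / 2) cH nH ltac:(lra).
have cz : continuous zeta := Cline_continuous _ _ (sz 0%N).
have incr s t : s < t -> zeta s < zeta t.
  move=> st; have [||x _ E] := @MVT_segment R zeta (derive1 zeta) s t (ltW st).
  - by move=> x _; apply: DeriveDef; rewrite ?derive1E.
  - exact: continuous_subspaceT.
  - by rewrite -subr_gt0 E mulr_gt0// subr_gt0.
have mono s t : s <= t -> zeta s <= zeta t.
  by rewrite le_eqVlt => /predU1P[->//|/incr/ltW].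
have zI t : I01 t -> I01 (zeta t).
  rewrite /I01/= !in_itv/= => /andP[/mono + /mono].
  by rewrite z0 z1 => -> ->.
have cPhi := contact_isotopy_reparam zeta sz zI alpha PhiH hPhiH.
have sF := smooth_tfun_reparam_ham zeta sz zI A H hH.
exists (reparam_ham zeta H), (reparam zeta PhiH), (reparam zeta h); split; last split.
- split => //; first exact: generates_reparam.
  exact: conformal_factor_reparam.
- exists zeta, id; split.
  + split => //; [exact: smooth_line_smooth01|move=> s t _ _; exact: mono].
  + by split => //; exact: smooth_line_smooth01 smooth_line_id.
  + by rewrite contact_dist_reparam_id.
  + exact: Coo_nbhs_refl cPhi.1 (hN _ cPhi).
have Fle t : I01 t -> ham_norm mu (reparam_ham zeta H t) <= norm_1oo mu H + eps / 2.
  move=> It; apply: le_trans (zP t It); rewrite /reparam_ham derive01E//.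
  apply: ler_ham_normZ => //; first exact: ltW.
  exact: slice_continuous (smooth_tfun_continuous A H hH) _ (zI t It).
split; rewrite /reparam ?z0 ?z1//.
- split; first exact: norm_1oo_le_norm_oo compM sF.
  apply: (@le_lt_trans _ _ (norm_1oo mu H + eps / 2)); last lra.
  apply: ge_sup; last by move=> _ [t It <-]; exact: Fle.
  have [t It] := @I01_nonempty R.
  by exists (ham_norm mu (reparam_ham zeta H t)), t.
- rewrite /dbar_iso (image_reparam zeta (fun t => dbar g (PhiH t) (PhiH 0)))//.
  by rewrite ltrDl.
- rewrite /conf_norm.
  have E : [set `|h (zeta p.1) p.2 - h 0 p.2| | p in I01 `*` [set: M]] =
      [set `|h p.1 p.2 - h 0 p.2| | p in I01 `*` [set: M]].
    apply/seteqP; split => _ [[t x] [/= It _] <-].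
      by exists (zeta t, x) => //; split => //; exact: zI.
    (* Applied to the identity, [image_reparam] says that [zeta] maps [[0, 1]] onto itself. *)
    have : [set s | s in I01] t by exists t.
    rewrite -(image_reparam zeta id)// => -[s Is <-].
    by exists (s, x).
  by rewrite E ltrDl.
Qed.
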